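(* Let $\alpha:I\to\mathbb{E}^4_1$ be a null Cartan curve with $\kappa_2'+\kappa_3\neq0$, and let $$R:=\frac{\kappa_2''+\kappa_3'}{\kappa_2'+\kappa_3}.$$ Then the tangent field $T=\alpha'$ satisfies the variable-coefficient ODE $$T^{(4)}-R\,T'''+\kappa_2^2\,T''-\bigl(R\kappa_2^2-3\kappa_2\kappa_2'\bigr)T'-\bigl(\kappa_2\kappa_3'+2\kappa_2'\kappa_3+\kappa_3^2-R\kappa_2\kappa_3\bigr)T=0 .$$ For constant curvatures ($R=0$) this reduces to $T^{(4)}+\kappa_2^2T''-\kappa_3^2T=0$.
   Context: Minkowski space-time $\mathbb{E}^4_1$ is $\mathbb{R}^4$ with the metric $\langle x,y\rangle=-x_1y_1+x_2y_2+x_3y_3+x_4y_4$. A null Cartan curve is a smooth null curve $\alpha:I\to\mathbb{E}^4_1$ ($I$ an interval, $\alpha'\neq0$, $\langle\alpha',\alpha'\rangle=0$) parametrized by pseudo-arc length $s$ (so $\langle\alpha'',\alpha''\rangle=1$), together with its Cartan frame $\{T,N,B_1,B_2\}$, $T=\alpha'$, $N=\alpha''$, where $\langle T,T\rangle=\langle B_2,B_2\rangle=0$, $\langle N,N\rangle=\langle B_1,B_1\rangle=1$, $\langle T,B_2\rangle=1$, all other inner products of frame vectors vanish, $\det(T,N,B_1,B_2)=1$, and $$T'=N,\quad N'=\kappa_2B_1-B_2,\quad B_1'=\kappa_3T-\kappa_2N,\quad B_2'=-\kappa_3B_1$$ for smooth functions $\kappa_2,\kappa_3:I\to\mathbb{R}$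 (the Cartan curvatures). Primes and $T^{(4)}$ denote derivatives with respect to $s$. *)

(* Defs.v *)
From HB Require Import structures.
From mathcomp Require Import all_boot all_order all_algebra.
From mathcomp Require Import all_classical all_reals all_analysis.

Set Implicit Arguments.
Unset Strict Implicit.
Unset Printing Implicit Defensive.

Import Order.TTheory GRing.Theory Num.Theory.
Import numFieldNormedType.Exports.

Local Open Scope classical_set_scope.
Local Open Scope ring_scope.

Section DerivativeOnASet.
Context {R : realType} {V : normedModType R}.
Implicit Types (I : set R) (f g : R -> V) (s : R) (n : nat).

(* [I] need not be open, so only increments [h] with [h + s] in [I] are used:
   the derivative is one-sided at an endpoint belonging to [I].  On an open set
   it is [f^`()], see [derive1_in_open] and [derive1n_in_open]. *)
Definition derive1_in I f s : V :=
  lim ((fun h => h^-1 *: (f (h + s) - f s)) @ within [set h | I (h + s)] 0^').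

Definition derivable1_in I f s : Prop :=
  cvg ((fun h => h^-1 *: (f (h + s) - f s)) @ within [set h | I (h + s)] 0^').

Definition derive1n_in I n f : R -> V := iter n (derive1_in I) f.

Definition smooth_in I f : Prop :=
  forall n s, I s -> derivable1_in I (derive1n_in I n f) s.

Lemma eq_derive1_in I f g s : I s -> (forall t, I t -> f t = g t) ->
  derive1_in I f s = derive1_in I g s.
Proof.
move=> Is fg; rewrite /derive1_in; congr (lim _).
apply/seteqP; split => A; rewrite /= !nbhs_filterE /within /=;
  apply: (@filterS _ 0^') => h /[swap] Ihs /(_ Ihs).
  by rewrite (fg _ Ihs) (fg _ Is).
by rewrite (fg _ Ihs) (fg _ Is).
Qed.

Lemma derive1_in_open I f s : open I -> I s ->
  derive1_in I f s = (f^`())%classic s.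
Proof.
move=> oI Is; rewrite /derive1_in /derive1.
suff -> : within [set h | I (h + s)] 0^' = (0 : R)^' by [].
have near0 : \forall h \near (0 : R)^', I (h + s).
  apply: cvg_within.
  have /(_ I) : (fun h : R => h + s) @ (0 : R) --> s.
    rewrite -[X in _ --> X]add0r.
    by apply: cvgD; [exact: cvg_id|exact: cvg_cst].
  by apply; exact: open_nbhs_nbhs.
apply/seteqP; split => A; last exact: cvg_within.
by move=> hA; apply: filterS2 near0 hA => h Ih; apply.
Qed.

Lemma derive1n_in_open I f n s : open I -> I s ->
  derive1n_in I n f s = (f^`(n))%classic s.
Proof.
move=> oI; elim: n s => [//|n IHn] s Is.
by rewrite derive1nS -(derive1_in_open _ oI Is); exact: eq_derive1_in.
Qed.

End DerivativeOnASet.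

Section NullCartanCurves.
Context {R : realType}.
Implicit Types I : set R.

Definition minkowski (x y : 'rV[R]_4) : R :=
  - (x 0 0 * y 0 0) + x 0 1 * y 0 1 + x 0 2 * y 0 2 + x 0 3 * y 0 3.

(* The last clause says that the parameter is the pseudo-arc length. *)
Record null_cartan_curve I (alpha : R -> 'rV[R]_4) : Prop := {
  curve_smooth : smooth_in I alpha ;
  curve_regular : forall s, I s -> derive1_in I alpha s != 0 ;
  curve_null : forall s, I s ->
    minkowski (derive1_in I alpha s) (derive1_in I alpha s) = 0 ;
  curve_pseudo_arc : forall s, I s ->
    minkowski (derive1n_in I 2 alpha s) (derive1n_in I 2 alpha s) = 1 }.

Record cartan_frame I (alpha T N B1 B2 : R -> 'rV[R]_4)
    (k2 k3 : R -> R) : Prop := {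
  frame_T : forall s, I s -> T s = derive1_in I alpha s ;
  frame_N : forall s, I s -> N s = derive1n_in I 2 alpha s ;
  frame_smooth_B1 : smooth_in I B1 ;
  frame_smooth_B2 : smooth_in I B2 ;
  frame_TT : forall s, I s -> minkowski (T s) (T s) = 0 ;
  frame_B2B2 : forall s, I s -> minkowski (B2 s) (B2 s) = 0 ;
  frame_NN : forall s, I s -> minkowski (N s) (N s) = 1 ;
  frame_B1B1 : forall s, I s -> minkowski (B1 s) (B1 s) = 1 ;
  frame_TB2 : forall s, I s -> minkowski (T s) (B2 s) = 1 ;
  frame_TN : forall s, I s -> minkowski (T s) (N s) = 0 ;
  frame_TB1 : forall s, I s -> minkowski (T s) (B1 s) = 0 ;
  frame_NB1 : forall s, I s -> minkowski (N s) (B1 s) = 0 ;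
  frame_NB2 : forall s, I s -> minkowski (N s) (B2 s) = 0 ;
  frame_B1B2 : forall s, I s -> minkowski (B1 s) (B2 s) = 0 ;
  frame_det : forall s, I s ->
    \det (\matrix_(i < 4) [:: T s; N s; B1 s; B2 s]`_i) = 1 ;
  frame_smooth_k2 : smooth_in I k2 ;
  frame_smooth_k3 : smooth_in I k3 ;
  frame_eqT : forall s, I s -> derive1_in I T s = N s ;
  frame_eqN : forall s, I s -> derive1_in I N s = k2 s *: B1 s - B2 s ;
  frame_eqB1 : forall s, I s ->
    derive1_in I B1 s = k3 s *: T s - k2 s *: N s ;
  frame_eqB2 : forall s, I s -> derive1_in I B2 s = - k3 s *: B1 s }.

Definition curvature_ratio I (k2 k3 : R -> R) (s : R) : R :=
  (derive1n_in I 2 k2 s + derive1_in I k3 s) / (derive1_in I k2 s + k3 s).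

End NullCartanCurves.

(* Main.v *)
Require Import Defs.
From mathcomp Require Import all_boot all_order all_algebra.
From mathcomp Require Import all_classical all_reals all_analysis.
From mathcomp Require Import ring lra.
Import Order.TTheory GRing.Theory Num.Theory.
Import numFieldNormedType.Exports.
Local Open Scope classical_set_scope.
Local Open Scope ring_scope.

(** The Cartan equations rewrite each derivative of [T] in the frame:
    [T' = N], [T'' = k2 B1 - B2], and, the two [B1] contributions adding up,
    [T''' = (k2' + k3) B1 + k2 k3 T - k2^2 N].
    Since [k2' + k3] does not vanish, [T, T', T'', T'''] determine
    [B1] and [B2].  In the next derivative [B1] enters through
    [(k2'' + k3') B1 - k2^2 (k2 B1 - B2)], whose second summand is
    [- k2^2 T''] and whose first is [r (k2' + k3) B1], that is
    [r (T''' - k2 k3 T + k2^2 N)].  Substituting leaves a relation between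
    [T] and its derivatives alone, which is the stated equation.

    Derivatives are taken along [I], hence one-sided at an endpoint.  The rules
    of calculus needed (linearity, Leibniz, constants) are therefore established
    for limits along increments that stay in [I].  Limits are unique because
    such increments accumulate at 0 when [I] is a nondegenerate interval. *)

(** * Calculus along a set *)

Section DerivativeRules.
Local Set Implicit Arguments.
Local Unset Strict Implicit.
Context {R : realType}.
Implicit Types (I : set R) (s : R).

Definition increments I s : set_system R := within [set h | I (h + s)] 0^'.

Lemma increments_filter I s : Filter (increments I s).
Proof. exact: within_filter. Qed.
#[local] Existing Instance increments_filter.

(** A point of [I] other than [s] is joined to [s] inside the interval, which
    gives arbitrarily small nonzero increments even when [s] is an endpoint.
    Properness is what makes the limits along these increments unique. *)
Lemma increments_proper I s :
  is_interval I -> I° !=set0 -> I s -> ProperFilter (increments I s).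
Proof.
move=> Iint [c Ic] Is; apply: Build_ProperFilter_ex.
suff [d Id ds] : exists2 d, I d & d != s.
  move=> A /nbhs_ballP[e /= e0 eA].
  (* the increment [t (d - s)] stays in [I] by convexity when [0 < t <= 1] *)
  have ds0 : 0 < `|d - s| by rewrite normr_gt0 subr_eq0.
  pose t := Num.min 1 (e / 2 / `|d - s|).
  have t0 : 0 < t by rewrite lt_min ltr01 !divr_gt0.
  have t1 : t <= 1 by rewrite ge_min lexx.
  have te : t * `|d - s| < e.
    apply: (@le_lt_trans _ _ (e / 2)); last by lra.
    by rewrite -ler_pdivlMr// ge_min lexx orbT.
  exists (t * (d - s)); apply: eA => /=.
  - by rewrite /ball /= sub0r normrN normrM (gtr0_norm t0).
  - by rewrite mulf_neq0 ?subr_eq0// gt_eqF.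
  - have [sd|sd] := leP s d.
      apply: (Iint _ _ Is Id); apply/andP; split; nra.
    apply: (Iint _ _ Id Is); apply/andP; split; nra.
move: Ic => /nbhs_ballP[e /= e0 eI].
have ce : I (c + e / 2).
  apply: eI; rewrite /ball /= opprD addrA subrr sub0r normrN gtr0_norm; lra.
have Ic : I c by apply: eI; exact: ballxx.
have [cs|cs] := eqVneq c s; last by exists c.
by exists (c + e / 2) => //; rewrite -cs; apply/eqP; lra.
Qed.

(** A relation rather than the total [derive1_in], so that the rules below
    deliver existence and value together. *)
Definition has_derivative_in {V : normedModType R} I (f : R -> V) s (l : V) :=
  (fun h => h^-1 *: (f (h + s) - f s)) @ increments I s --> l.

Section VectorValued.
Context {V : normedModType R}.
Implicit Types (f g : R -> V) (l m : V).

Lemma smooth_has_derivative I n f s : smooth_in I f -> I s ->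
  has_derivative_in I (derive1n_in I n f) s (derive1n_in I n.+1 f s).
Proof. by move=> sf Is; exact: sf. Qed.

Lemma has_derivative_in_eq I f s l :
    is_interval I -> I° !=set0 -> I s ->
  has_derivative_in I f s l -> derive1_in I f s = l.
Proof.
move=> Iint I0 Is fl; have ? := increments_proper Iint I0 Is.
exact: cvg_lim fl.
Qed.

Lemma has_derivative_in_ext I f g s l : I s -> (forall t, I t -> f t = g t) ->
  has_derivative_in I f s l -> has_derivative_in I g s l.
Proof.
move=> Is fg; apply: cvg_trans; apply: near_eq_cvg.
rewrite /increments near_withinE; apply: nearW => h Ih.
by rewrite (fg _ Ih) (fg _ Is).
Qed.

Lemma has_derivative_in_cst I (c : V) s :
  has_derivative_in I (cst c) s 0.
Proof.
rewrite /has_derivative_in /cst subrr.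
by under eq_fun do rewrite scaler0; exact: cvg_cst.
Qed.

Lemma has_derivative_inD I f g s l m :
  has_derivative_in I f s l -> has_derivative_in I g s m ->
  has_derivative_in I (fun t => f t + g t) s (l + m).
Proof.
move=> fl gm; apply: cvg_trans (cvgD fl gm); apply: near_eq_cvg.
by apply: nearW => h; rewrite !fctE -scalerDr opprD addrACA.
Qed.

Lemma has_derivative_inN I f s l :
  has_derivative_in I f s l -> has_derivative_in I (fun t => - f t) s (- l).
Proof.
move=> fl; apply: cvg_trans (cvgN fl); apply: near_eq_cvg.
by apply: nearW => h; rewrite !fctE -scalerN opprD.
Qed.

(** For [h != 0], [f (h + s)] is [f s] plus [h] times the difference quotient;
    the Leibniz rule needs this for the factor evaluated at [h + s]. *)
Lemma has_derivative_in_continuous I f s l :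
  has_derivative_in I f s l -> f (h + s) @[h --> increments I s] --> f s.
Proof.
move=> fl.
have h0 : h @[h --> increments I s] --> (0 : R).
  move=> A A0; change (increments I s A).
  by apply: cvg_within; exact: cvg_within A0.
rewrite -[X in _ --> X]add0r -(scale0r l).
apply: cvg_trans (cvgD (cvgZ h0 fl) (cvg_cst (f s))); apply: near_eq_cvg.
rewrite /increments near_withinE near_withinE; apply: nearW => h h_neq0 _; rewrite !fctE.
by rewrite scalerA divff// scale1r subrK.
Qed.

Lemma has_derivative_inZ I (a : R -> R) f s (a' : R) l :
  has_derivative_in I a s a' -> has_derivative_in I f s l ->
  has_derivative_in I (fun t => a t *: f t) s (a' *: f s + a s *: l).
Proof.
move=> da df.
apply: cvg_trans (cvgD (cvgZ da (has_derivative_in_continuous df))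
                       (cvgZ (cvg_cst (a s)) df)).
apply: near_eq_cvg; apply: nearW => h; rewrite !fctE.
rewrite scalerA [a s * _]mulrC -!scalerA -scalerDr scalerBl scalerBr.
by rewrite addrA subrK.
Qed.

End VectorValued.
End DerivativeRules.

(** * Derivatives of the tangent in the Cartan frame *)

Section TangentDerivatives.
Local Set Implicit Arguments.
Local Unset Strict Implicit.
Context {R : realType} {I : set R} {alpha T N B1 B2 : R -> 'rV[R]_4}.
Context {k2 k3 : R -> R}.
Hypotheses (I_interval : is_interval I) (I_nondegenerate : I° !=set0).
Hypotheses (alpha_cartan : null_cartan_curve I alpha)
  (frame : cartan_frame I alpha T N B1 B2 k2 k3).

(** The Cartan equations give only the values of the derivatives.  That the
    limits exist comes from the smoothness of [alpha] for [T] and [N], which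
    agree with derivatives of [alpha] on [I], and from that of [B1] and [B2]. *)
Lemma T_has_derivative s : I s -> has_derivative_in I T s (N s).
Proof.
move=> Is; rewrite (frame_N frame Is).
apply: (has_derivative_in_ext Is (f := derive1n_in I 1 alpha)).
  by move=> t It; rewrite (frame_T frame It).
exact: smooth_has_derivative (curve_smooth alpha_cartan) Is.
Qed.

Lemma N_has_derivative s :
  I s -> has_derivative_in I N s (k2 s *: B1 s - B2 s).
Proof.
move=> Is; rewrite -(frame_eqN frame Is).
rewrite (eq_derive1_in Is (frame_N frame)).
apply: (has_derivative_in_ext Is (f := derive1n_in I 2 alpha)).
  by move=> t It; rewrite (frame_N frame It).
exact: smooth_has_derivative (curve_smooth alpha_cartan) Is.
Qed.

Lemma B1_has_derivative s :
  I s -> has_derivative_in I B1 s (k3 s *: T s - k2 s *: N s).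
Proof.
move=> Is; rewrite -(frame_eqB1 frame Is).
exact: (smooth_has_derivative (n := 0) (frame_smooth_B1 frame) Is).
Qed.

Lemma B2_has_derivative s : I s -> has_derivative_in I B2 s (- k3 s *: B1 s).
Proof.
move=> Is; rewrite -(frame_eqB2 frame Is).
exact: (smooth_has_derivative (n := 0) (frame_smooth_B2 frame) Is).
Qed.

Lemma tangent_derivative2 s :
  I s -> derive1n_in I 2 T s = k2 s *: B1 s - B2 s.
Proof.
move=> Is; rewrite -(frame_eqN frame Is).
exact: eq_derive1_in Is (frame_eqT frame).
Qed.

Lemma tangent_derivative3 s : I s -> derive1n_in I 3 T s =
  (derive1_in I k2 s + k3 s) *: B1 s
    + (k2 s * k3 s) *: T s - (k2 s ^+ 2) *: N s.
Proof.
move=> Is; rewrite [LHS](eq_derive1_in Is tangent_derivative2).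
have dk2 := smooth_has_derivative (n := 0) (frame_smooth_k2 frame) Is.
rewrite (has_derivative_in_eq I_interval I_nondegenerate Is
  (has_derivative_inD (has_derivative_inZ dk2 (B1_has_derivative Is))
     (has_derivative_inN (B2_has_derivative Is)))) /=.
by apply/rowP => i; rewrite !mxE; ring.
Qed.

(** Left unsimplified, so that the part along [T''], here
    [k2 s *: B1 s - B2 s], stays visible next to the multiple of [B1]. *)
Lemma tangent_derivative4 s : I s -> derive1n_in I 4 T s =
  (derive1n_in I 2 k2 s + derive1_in I k3 s) *: B1 s
    + (derive1_in I k2 s + k3 s) *: (k3 s *: T s - k2 s *: N s)
    + (derive1_in I k2 s * k3 s + k2 s * derive1_in I k3 s) *: T s
    + (k2 s * k3 s) *: N s
    - (2 * k2 s * derive1_in I k2 s) *: N s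
    - (k2 s ^+ 2) *: (k2 s *: B1 s - B2 s).
Proof.
move=> Is; rewrite [LHS](eq_derive1_in Is tangent_derivative3).
have dk2 := smooth_has_derivative (n := 0) (frame_smooth_k2 frame) Is.
have ddk2 := smooth_has_derivative (n := 1) (frame_smooth_k2 frame) Is.
have dk3 := smooth_has_derivative (n := 0) (frame_smooth_k3 frame) Is.
(* products of scalars are scalings in [R] as a module over itself *)
rewrite (has_derivative_in_eq I_interval I_nondegenerate Is
  (has_derivative_inD (has_derivative_inD
     (has_derivative_inZ (has_derivative_inD ddk2 dk3) (B1_has_derivative Is))
     (has_derivative_inZ (has_derivative_inZ dk2 dk3) (T_has_derivative Is)))
     (has_derivative_inN (has_derivative_inZ (has_derivative_inZ dk2 dk2)
        (N_has_derivative Is))))) /=.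
by apply/rowP => i; rewrite !mxE /GRing.scale /=; ring.
Qed.

End TangentDerivatives.

(** * The differential equation *)

Theorem theorem10 (R : realType) (I : set R)
    (alpha T N B1 B2 : R -> 'rV[R]_4) (k2 k3 : R -> R)
    (I_interval : is_interval I) (I_nondegenerate : I° !=set0)
    (alpha_cartan : null_cartan_curve I alpha)
    (frame : cartan_frame I alpha T N B1 B2 k2 k3)
    (k23_neq0 : forall s, I s -> derive1_in I k2 s + k3 s != 0) :
  (forall s, I s ->
     let r := curvature_ratio I k2 k3 s in
     derive1n_in I 4 T s - r *: derive1n_in I 3 T s
       + k2 s ^+ 2 *: derive1n_in I 2 T s
       - (r * k2 s ^+ 2 - 3 * k2 s * derive1_in I k2 s) *: derive1_in I T s
       - (k2 s * derive1_in I k3 s + 2 * derive1_in I k2 s * k3 s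
            + k3 s ^+ 2 - r * k2 s * k3 s) *: T s = 0)
  /\ (forall c2 c3 : R, (forall s, I s -> k2 s = c2 /\ k3 s = c3) ->
      forall s, I s ->
        curvature_ratio I k2 k3 s = 0 /\
        derive1n_in I 4 T s + c2 ^+ 2 *: derive1n_in I 2 T s
          - c3 ^+ 2 *: T s = 0).
Proof.
have split_dep (A B : Prop) : A -> (A -> B) -> A /\ B by move=> a /(_ a).
apply: split_dep => [s Is r|ode c2 c3 kc s Is].
  have rE : derive1n_in I 2 k2 s + derive1_in I k3 s
      = r * (derive1_in I k2 s + k3 s).
    by rewrite /r /curvature_ratio divfK// k23_neq0.
  rewrite (tangent_derivative4 I_interval I_nondegenerate alpha_cartan frame Is).
  rewrite (tangent_derivative3 I_interval I_nondegenerate frame Is) rE.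
  rewrite (tangent_derivative2 frame Is) (frame_eqT frame Is).
  by apply/rowP => i; rewrite !mxE; ring.
have dcst (k : R -> R) c t :
    (forall t, I t -> k t = c) -> I t -> derive1_in I k t = 0.
  move=> kE It; rewrite (eq_derive1_in (g := cst c) It kE).
  apply: (has_derivative_in_eq I_interval I_nondegenerate It).
  exact: has_derivative_in_cst.
have dk2 t : I t -> derive1_in I k2 t = 0.
  by apply: (dcst _ c2) => u /kc[].
have dk3 : derive1_in I k3 s = 0 by apply: (dcst _ c3) => // u /kc[].
have ddk2 : derive1n_in I 2 k2 s = 0 by apply: (dcst _ 0).
have r0 : curvature_ratio I k2 k3 s = 0.
  by rewrite /curvature_ratio ddk2 dk3 addr0 mul0r.
split=> //; have := ode s Is; have [-> ->] := kc s Is.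
cbv zeta; rewrite r0 (dk2 s Is) dk3.
by rewrite !mulr0 !mul0r !subr0 add0r !scale0r !subr0 add0r.
Qed.
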